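(* Suppose $\ell=1$ (so $R=F_q$, $A=F_q[y]$ with $y^2=0$) and $m\ge 2$, and write $m=2r$ or $m=2r+1$ according to the parity of $m$, where $r\ge 1$. Let $s\in S$ and let $t=h(s,s)\in F_q$. The degree of either of the irreducible constituents $Top^{\pm}(s)$ of the Weil module of $U$ is given as follows. $\deg(Top^{\pm}(s))=\dfrac{q^r(q^r+1)}{2}$ in the following cases: (a1) $m=2r+1$, $b$ of type $1$, $-1\in F_q^{\times 2}$, $t\in F_q^{\times 2}$; (a2) $m=2r+1$, $b$ of type $1$, $-1\in F_q^\times\setminus F_q^{\times 2}$, $t\in F_q^\times\setminus F_q^{\times 2}$; (a3) $m=2r+1$, $b$ of type $\delta$, $-1\in F_q^{\times 2}$, $t\in F_q^\times\setminus F_q^{\times 2}$; (a4) $m=2r+1$, $b$ of type $\delta$, $-1\in F_q^\times\setminus F_q^{\times 2}$, $t\in F_q^{\times 2}$. $\deg(Top^{\pm}(s))=\dfrac{q^r(q^r-1)}{2}$ in the following cases: (b1) $m=2r+1$, $b$ of type $1$, $-1\in F_q^{\times 2}$, $t\in F_q^\times\setminus F_q^{\times 2}$; (b2) $m=2r+1$, $b$ of type $1$, $-1\in F_q^\times\setminus F_q^{\times 2}$, $t\in F_q^{\times 2}$; (b3) $m=2r+1$, $b$ of type $\delta$, $-1\in F_q^{\times 2}$, $t\in F_q^{\times 2}$; (b4) $m=2r+1$, $b$ of type $\delta$, $-1\in F_q^\times\setminus F_q^{\times 2}$, $t\in F_q^\times\setminus F_q^{\times 2}$. (c) $\deg(Top^{\pm}(s))=\dfrac{q^{r-1}(q^r+1)}{2}$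 if $m=2r$, $b$ is of type $\delta$, and $t\in F_q^\times$. (d) $\deg(Top^{\pm}(s))=\dfrac{q^{r-1}(q^r-1)}{2}$ if $m=2r$, $b$ is of type $1$, and $t\in F_q^\times$. (e) $\deg(Top^{\pm}(s))=\dfrac{(q^r-1)(q^{r-1}+1)}{2}$ if $m=2r$, $b$ is of type $1$, and $t=0$. (f) $\deg(Top^{\pm}(s))=\dfrac{(q^r+1)(q^{r-1}-1)}{2}$ if $m=2r>2$, $b$ is of type $\delta$, and $t=0$. (g) $\deg(Top^{\pm}(s))=\dfrac{q^{2r}-1}{2}$ if $m=2r+1$, $b$ is of either type, and $t=0$.
   Context: Setting. $F_q$ is a finite field of odd characteristic, $A=F_q[y]=F_q\oplus F_qy$ with $y^2=0$ and involution $(r+sy)^*=r-sy$ ($r,s\in F_q$). $V$ is a free $A$-module of finite rank $m$ and $h:V\times V\to A$ is a non-degenerate hermitian form: $h$ is bi-additive, $A$-linear in the second variable, $h(v,u)=h(u,v)^*$, and $v\mapsto h(v,-)$ is a bijection $V\to\mathrm{Hom}_A(V,A)$. $U=U_m(A)=\{g\in\mathrm{GL}_A(V): h(gu,gv)=h(u,v)\ \forall u,v\in V\}$. Fix a non-trivial linear character $\lambda:F_q^+\to\mathbf C^\times$ and let $\mu:A^+\to\mathbf C^\times$, $\mu(r+sy)=\lambda(2s)$. Let $T$ be a transversal for $yV$ in $V$ which is symmetric ($v\in T$ iff $-v\in T$). The Weil module $X$ is the complex $U$-module with basis $\{e_v:v\in T\}$ and action $ge_v=\mu(h(gv,v'))e_{v'}$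 for $g\in U$, $v,v'\in T$, $gv\equiv v'\bmod yV$. $Top$ is the submodule spanned by the $e_v$ with $0\ne v\in T$ (equivalently $v\in T\setminus yV$), and $Top^{\pm}$ are the $\pm1$-eigenspaces on $Top$ of the central element $\iota\in U$, $v\mapsto -v$. Let $S\subseteq T$ be a set of representatives for the equivalence relation on $V\setminus yV$ given by: $v\sim w$ if $gv\equiv w\bmod yV$ for some $g\in U$ (equivalently $h(v,v)=h(w,w)$). For $s\in S$, $Top^{\pm}(s)$ is the $U$-submodule of $Top^{\pm}$ generated by $e_s\pm e_{-s}$; it is irreducible. Degree means complex dimension. $b$ is the non-degenerate symmetric bilinear form on the $m$-dimensional $F_q$-vector space $V/yV$ induced by $h$, with values in $A/Ay=F_q$. $F_q^{\times 2}$ is the group of non-zero squares of $F_q$ and $\delta\in F_q^\times\setminus F_q^{\times 2}$ is fixed. $b$ is of type $1$ (resp. type $\delta$) if it has, relative to some basis, the matrix: for $m=2r$, $\mathrm{diag}(1,-1,\dots,1,-1)$ (resp. $\mathrm{diag}(1,-1,\dots,1,-1,1,-\delta)$, i.e. the same with last entry $-\delta$); for $m=2r+1$, $\mathrm{diag}(1,-1,\dots,1,-1,-1)$ (resp. $\mathrm{diag}(1,-1,\dots,1,-1,-\delta)$), with $r$ pairs $1,-1$ followed by the last entry. *)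

(* Defs.v *)
From HB Require Import structures.
From mathcomp Require Import all_boot all_order all_algebra all_fingroup.
From mathcomp Require Import qpoly complex reals.
Set Implicit Arguments.
Unset Strict Implicit.
Unset Printing Implicit Defensive.
Import GRing.Theory Num.Theory.
Local Open Scope ring_scope.

(* An element a = r + s y of F[y], y^2 = 0, is stored as a polynomial of       *)
(* size at most 2: r = a`_0 and s = a`_1.                                      *)
Notation dual F := {poly %/ ('X^2 : {poly F})}.

Section Weil.
Variable F : finFieldType.
Local Notation A := (dual F).

Definition dy : A := 'qX.

Definition dstar (a : A) : A := (a`_0)%:A - a`_1 *: dy.

Definition nzsquare (x : F) : Prop := exists2 z : F, z != 0 & x = z ^+ 2.
Definition nznonsquare (x : F) : Prop := x != 0 /\ ~ nzsquare x.

Variable V : finLmodType A.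

Definition free_of_rank (m : nat) : Prop :=
  exists e : 'I_m -> V,
    forall v, exists! c : {ffun 'I_m -> A}, v = \sum_i c i *: e i.

Record nondeg_hermitian (h : V -> V -> A) : Prop := NondegHermitian {
  herm_addl : forall u u' v, h (u + u') v = h u v + h u' v;
  herm_addr : forall u v v', h u (v + v') = h u v + h u v';
  herm_scaler : forall a u v, h u (a *: v) = a * h u v;
  herm_conj : forall u v, h v u = dstar (h u v);
  herm_nondeg : forall f : {linear V -> A^o}, exists! v, forall w, h v w = f w
}.

Definition yV : {set V} := [set dy *: v | v : V].

Definition symmetric_transversal (T : {set V}) : Prop :=
  (forall v, exists! t, t \in T /\ v - t \in yV) /\
  (forall v, (v \in T) = (- v \in T)).

Variable h : V -> V -> A.

(* The product of {perm V} is (g * k) v = k (g v), opposite to composition.    *)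
Definition unitary : {set {perm V}} :=
  [set g : {perm V} |
     [forall a : A, forall u, forall v, g (a *: u + v) == a *: g u + g v] &&
     [forall u, forall v, h (g u) (g v) == h u v]].

Definition unitary_equiv (v w : V) : Prop :=
  exists2 g : {perm V}, g \in unitary & g v - w \in yV.

Definition orbit_reps (T S : {set V}) : Prop :=
  [/\ S \subset T,
      forall s, s \in S -> s \notin yV &
      forall v, v \notin yV -> exists! s, s \in S /\ unitary_equiv v s].

(* The form induced by h on V/yV, evaluated on lifts to V; a |-> a`_0          *)
(* identifies A/Ay with F.                                                     *)
Definition red_form (u v : V) : F := (h u v)`_0.

(* A family in V whose classes form an F-basis of V/yV.                        *)
Definition red_basis m (e : 'I_m -> V) : Prop :=
  forall v, exists! c : {ffun 'I_m -> F},
    v - \sum_i (c i)%:A *: e i \in yV.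

(* 1, -1, 1, -1, ... with the last entry replaced by - d.                      *)
Definition type_diag m (d : F) : 'rV[F]_m :=
  \row_(i < m) (if i.+1 == m then - d else (-1) ^+ i).

Definition of_type m (d : F) : Prop :=
  exists e : 'I_m -> V, red_basis e /\
    \matrix_(i, j) red_form (e i) (e j) = diag_mx (type_diag m d).

Section Module.
Variable R : realType.
Local Notation C := R[i].

Record nontrivial_char (lam : F -> C) : Prop := NontrivialChar {
  char_neq0 : forall x, lam x != 0;
  char_add : forall x y, lam (x + y) = lam x * lam y;
  char_nontrivial : exists x, lam x != 1
}.

Variable lam : F -> C.

Definition mu (a : A) : C := lam (2 * a`_1).

Variable T : {set V}.

Definition weil := {ffun {v : V | v \in T} -> C^o}.

Definition weil_e (v : V) : weil := [ffun w => (val w == v)%:R].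

(* The inner sum has exactly one term when T is a transversal for yV.          *)
Definition weil_act (g : {perm V}) (x : weil) : weil :=
  \sum_(v : {v : V | v \in T})
    \sum_(w : {v : V | v \in T} | g (val v) - val w \in yV)
      (x v * mu (h (g (val v)) (val w))) *: weil_e (val w).

Definition submodule (W : {vspace weil}) : Prop :=
  forall g x, g \in unitary -> x \in W -> weil_act g x \in W.

(* The span of the U-orbit of x; submodule_genP shows that this is the         *)
(* smallest submodule containing x.                                            *)
Definition submodule_gen (x : weil) : {vspace weil} :=
  (\sum_(g in unitary) <[weil_act g x]>)%VS.

(* Top^+(s) for sgn = false and Top^-(s) for sgn = true.                       *)
Definition Top_pm (sgn : bool) (s : V) : {vspace weil} :=
  submodule_gen (weil_e s + (-1) ^+ sgn *: weil_e (- s)).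

Hypothesis hh : nondeg_hermitian h.
Hypothesis hlam : nontrivial_char lam.
Hypothesis hT : symmetric_transversal T.

Fact dyE : dy = 'X :> {poly F}.
Proof. by apply: qpolyXE; rewrite ?size_polyXn ?monicXn. Qed.

Fact dstarE (a : A) : dstar a = (a`_0)%:P - a`_1 *: 'X :> {poly F}.
Proof.
by rewrite -[RHS]/(_ - _ *: _) -alg_polyC; congr (_ - _ *: _); apply: dyE.
Qed.

Fact dual_mulE (a b : A) :
  a * b = Pdiv.CommonRing.rmodp ((a : {poly F}) * b) 'X^2 :> {poly F}.
Proof.
rewrite [LHS]poly_of_qpolyM; congr Pdiv.CommonRing.rmodp.
exact: mk_monic_Xn.
Qed.

Fact dy_sqr0 : dy * dy = 0.
Proof.
apply/val_inj; rewrite [LHS]dual_mulE dyE -expr2.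
by rewrite Pdiv.RingMonic.rmodpp ?monicXn.
Qed.

Fact coef0_dyM (c : A) : (dy * c)`_0 = 0.
Proof.
rewrite dual_mulE dyE.
have e := Pdiv.RingMonic.rdivp_eq (monicXn F 2) ('X * (c : {poly F})).
by have := coefXM (c : {poly F}) 0; rewrite {1}e coefD coefMXn /= add0r.
Qed.

Fact dy_dstar (c : A) : dy * dstar (dy * c) = 0.
Proof.
rewrite /dstar coef0_dyM scale0r sub0r mulrN -scalerAr dy_sqr0 scaler0.
by rewrite oppr0.
Qed.

Fact herm_yy u v : h (dy *: u) (dy *: v) = 0.
Proof.
by rewrite (herm_scaler hh) (herm_conj hh v) (herm_scaler hh) dy_dstar.
Qed.

Fact lam0 : lam 0 = 1.
Proof.
apply: (mulfI (char_neq0 hlam 0)).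
by rewrite -(char_add hlam) addr0 mulr1.
Qed.

Fact muD : {morph mu : a b / a + b >-> a * b}.
Proof. by move=> a b; rewrite /mu coefD mulrDr (char_add hlam). Qed.

Fact mu_diag v : mu (h v v) = 1.
Proof.
rewrite /mu -lam0; congr lam; move: (herm_conj hh v v).
set a := h v v => /(congr1 (fun a : A => a`_1)).
rewrite dstarE coefD coefN coefZ coefX mulr1 coefC sub0r.
by move=> e; rewrite mulr2n mulrDl mul1r {1}e addNr.
Qed.

Fact yVP v : reflect (exists u, v = dy *: u) (v \in yV).
Proof. by apply: (iffP imsetP) => [[u _ ->]|[u ->]]; exists u. Qed.

Fact yVD u v : u \in yV -> v \in yV -> u + v \in yV.
Proof.
move=> /yVP[a ->] /yVP[b ->]; apply/yVP; exists (a + b).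
by rewrite scalerDr.
Qed.

Fact yVN v : v \in yV -> - v \in yV.
Proof. by move=> /yVP[a ->]; apply/yVP; exists (- a); rewrite scalerN. Qed.

Fact unitaryP (g : {perm V}) :
  reflect (linear g /\ forall u v, h (g u) (g v) = h u v) (g \in unitary).
Proof.
rewrite inE; apply: (iffP andP) => -[gl gh]; split.
- by move=> a u v; move/forallP: gl => /(_ a)/forallP/(_ u)/forallP/(_ v)/eqP.
- by move=> u v; move/forallP: gh => /(_ u)/forallP/(_ v)/eqP.
- by apply/forallP => a; apply/forallP=> u; apply/forallP=> v; apply/eqP/gl.
- by apply/forallP=> u; apply/forallP=> v; apply/eqP/gh.
Qed.

Fact unitary_group_set : group_set unitary.
Proof.
apply/group_setP; split=> [|g k /unitaryP[gl gh] /unitaryP[kl kh]].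
  by apply/unitaryP; split=> [a u v|u v]; rewrite !perm1.
by apply/unitaryP; split=> [a u v|u v]; rewrite !permM ?gl ?kl ?kh ?gh.
Qed.

Local Notation TT := {v : V | v \in T}.

Fact weil_act_linear g : linear (weil_act g).
Proof.
move=> a x y; rewrite /weil_act scaler_sumr -big_split; apply: eq_bigr => v _.
rewrite scaler_sumr -big_split; apply: eq_bigr => w _ /=.
by rewrite scalerA !ffunE -scalerDl mulrDl mulrA.
Qed.

Fact weil_act_e (g : {perm V}) (v w : TT) : g (val v) - val w \in yV ->
  weil_act g (weil_e (val v)) = mu (h (g (val v)) (val w)) *: weil_e (val w).
Proof.
move=> gvw; rewrite /weil_act (bigD1 v) //= [X in _ + X]big1 => [|u uv].
  rewrite addr0 (big_pred1 w) => [|u /=]; first by rewrite ffunE eqxx mul1r.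
  have [t [_ tu]] := hT.1 (g (val v)).
  apply/idP/eqP => [gvu|-> //]; apply/val_inj.
  by rewrite -(tu (val u)) ?(tu (val w)) //; split=> //; apply: valP.
rewrite big1 // => w' _; rewrite ffunE.
by rewrite (inj_eq val_inj) (negPf uv) mul0r scale0r.
Qed.

Fact transE (v : V) : {w : TT | v - val w \in yV}.
Proof.
have := hT.1 v => ex; pose P (w : TT) := v - val w \in yV.
suff eP: exists w, P w by exists (xchoose eP); apply: (xchooseP eP).
by have [t [[tT vt] _]] := ex; exists (exist _ t tT).
Qed.

Fact weilE (x : weil) : x = \sum_v x v *: weil_e (val v).
Proof.
apply/ffunP => w; rewrite sum_ffunE (bigD1 w) //= big1 => [|v vw].
  by rewrite !ffunE eqxx addr0 [RHS]mulr1.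
by rewrite !ffunE (inj_eq val_inj) eq_sym (negPf vw) [LHS]mulr0.
Qed.

HB.instance Definition _ g :=
  GRing.isLinear.Build C weil weil _ (weil_act g) (weil_act_linear g).

Fact weil_actE g x :
  weil_act g x = \sum_v x v *: weil_act g (weil_e (val v)).
Proof.
by rewrite {1}[x]weilE linear_sum; apply: eq_bigr => v _; rewrite linearZ.
Qed.

Fact weil_act1 x : weil_act 1%g x = x.
Proof.
rewrite weil_actE [in RHS](weilE x); apply: eq_bigr => v _.
rewrite (@weil_act_e 1%g v v) perm1 ?mu_diag ?scale1r //.
by apply/yVP; exists 0; rewrite scaler0 subrr.
Qed.

Fact weil_actM g k x : g \in unitary -> k \in unitary ->
  weil_act (k * g)%g x = weil_act g (weil_act k x).
Proof.
move=> /unitaryP[gl gh] /unitaryP[kl kh].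
rewrite [in LHS]weil_actE [weil_act k x]weil_actE linear_sum.
apply: eq_bigr => v _; rewrite linearZ; congr (_ *: _).
have [v' kv] := transE (k (val v)); have [v2 gv] := transE (g (val v')).
rewrite (weil_act_e kv) linearZ /= (weil_act_e gv) scalerA.
case/yVP: kv => u /eqP; rewrite subr_eq => /eqP ku.
case/yVP: gv => w /eqP; rewrite subr_eq => /eqP gw.
have gku : g (k (val v)) = dy *: g u + g (val v').
  by rewrite ku gl.
have gkv : (k * g)%g (val v) - val v2 \in yV.
  rewrite permM gku gw addrA addrK; apply: yVD; apply/yVP; last by exists w.
  by exists (g u).
rewrite (weil_act_e gkv) permM; congr (_ *: _).
rewrite gku ku !(herm_addl hh) !muD mu_diag mulr1; congr (_ * _).
have gy : g (dy *: u) = dy *: g u.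
  have /= := gl 1 0 0; rewrite !scale1r addr0 => /esym/eqP.
  rewrite -subr_eq0 addrK => /eqP g0.
  by have := gl dy u 0; rewrite g0 !addr0.
have <- : h (dy *: g u) (g (val v')) = h (dy *: g u) (val v2).
  by rewrite gw (herm_addr hh) herm_yy add0r.
by rewrite -gy gh.
Qed.

Fact submodule_genP x :
  [/\ x \in submodule_gen x, submodule (submodule_gen x) &
      forall W : {vspace weil}, submodule W -> x \in W ->
        (submodule_gen x <= W)%VS].
Proof.
have U1 : 1%g \in unitary by case/group_setP: unitary_group_set.
split.
- rewrite -{1}[x]weil_act1; apply: (subvP (sumv_sup 1%g _ (subvv _))) => //.
  exact: memv_line.
- move=> g z gU /memv_sumP[zs zsx ->]; rewrite linear_sum.
  apply: memv_suml => k kU; have /vlineP[c ->] := zsx _ kU.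
  rewrite linearZ /= memvZ // -weil_actM //.
  have kgU : (k * g)%g \in unitary.
    by case/group_setP: unitary_group_set => _; apply.
  apply: (subvP (sumv_sup (k * g)%g _ (subvv _))) => //.
  exact: memv_line.
- move=> W WU xW; apply/subv_sumP => g gU; rewrite -memvE; exact: WU.
Qed.

End Module.
End Weil.

(* Main.v *)
(* Top^+-(s) is spanned by the vectors e_v +- e_{-v} with v in T congruent     *)
(* mod yV to a vector of the U-orbit of s, so its degree is half the number of *)
(* such v.  Orthogonal reflections of V/yV lift to U, and products of at most  *)
(* two of them, up to sign, act transitively on the non-zero vectors of given  *)
(* norm t; hence the degree is half the number of non-zero solutions of        *)
(* b(v,v) = t.  Splitting off a hyperbolic plane multiplies the deviation of   *)
(* that number from its mean by q, and replacing the last diagonal entry -1 by *)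
(* -delta negates the deviation, which leaves forms of dimension 0 and 1.      *)
Require Import Defs.
From HB Require Import structures.
From mathcomp Require Import all_boot all_order all_algebra all_fingroup.
From mathcomp Require Import qpoly complex reals.
From mathcomp Require Import ring.
Set Implicit Arguments.
Unset Strict Implicit.
Unset Printing Implicit Defensive.
Import GRing.Theory Num.Theory.
Local Open Scope ring_scope.

(** A unitary [g] sends the vector e_v ± e_{-v} to a non-zero multiple of e_w ± e_{-w}, where w in
    [T] represents g v ([weil_act_pm]), and U is transitive on the non-zero vectors of V/yV of a
    given norm ([unitary_transitive]). So one vector for each pair v, -v of norm t gives a basis of
    the module ([dim_Top_pm]), and the degree is half of N(t) - [t = 0], where N(t) counts the
    solutions of b(v,v) = t in V/yV ([deg_Top_pm_count]).

    N(t) is compared with its mean q^(m-1). A hyperbolic plane multiplies the deviation by q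
    ([diag_count_hyperbolic]), and passing from type 1 to type delta negates it
    ([diag_count_twist]). Splitting r planes off a form of type 1 leaves dimension 0 if m = 2r, with
    N(t) = [t = 0], and the form -x^2 if m = 2r+1, with N(t) equal to 2, 0 or 1 as -t is a non-zero
    square, a non-square or zero. Whether -t is a square is decided by the classes of -1 and t,
    whence the eight odd cases with t non-zero. *)

(** * Coordinates on the dual numbers *)

Section DualNumbers.
Variable F : finFieldType.
Implicit Types a b : dual F.

Definition dRe (a : dual F) : F := a`_0.
Definition dIm (a : dual F) : F := a`_1.

(** Residues modulo X^2 have size at most 2. Identities in A thus become pairs of identities in F,
    within reach of [ring] and [field]. *)
Lemma dual_eq a b : dRe a = dRe b -> dIm a = dIm b -> a = b.
Proof.
move=> e0 e1; apply/val_inj/polyP => -[|[|i]] //.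
have sz (c : dual F) : (size (c : {poly F}) <= 2)%N.
  by apply: leq_trans (size_npoly c) _; rewrite mk_monic_Xn size_polyXn.
by rewrite !nth_default // (leq_trans (sz _)).
Qed.

(** Reduction modulo X^2 leaves the coefficients below degree 2 unchanged. *)
Lemma coef_dualM a b i : (i < 2)%N ->
  (a * b)`_i = ((a : {poly F}) * (b : {poly F}))`_i.
Proof.
move=> i2; rewrite dual_mulE.
have e := Pdiv.RingMonic.rdivp_eq (monicXn F 2) ((a : {poly F}) * (b : {poly F})).
by rewrite {2}e coefD coefMXn i2 add0r.
Qed.

Lemma dReM a b : dRe (a * b) = dRe a * dRe b.
Proof. by rewrite /dRe coef_dualM // coefM big_ord1. Qed.

Lemma dImM a b : dIm (a * b) = dRe a * dIm b + dIm a * dRe b.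
Proof. by rewrite /dIm coef_dualM // coefM big_ord_recr big_ord1. Qed.

Lemma dual_algE (k : F) : (k%:A : dual F) = k%:P :> {poly F}.
Proof. by rewrite -alg_polyC. Qed.

Lemma dRe_alg (k : F) : dRe k%:A = k.
Proof. by rewrite /dRe dual_algE coefC. Qed.

Lemma dIm_alg (k : F) : dIm k%:A = 0.
Proof. by rewrite /dIm dual_algE coefC. Qed.

Lemma dRe0 : dRe 0 = 0. Proof. exact: coef0. Qed.
Lemma dIm0 : dIm 0 = 0. Proof. exact: coef0. Qed.

Lemma dRe1 : dRe 1 = 1.
Proof. by rewrite -[RHS]dRe_alg scale1r. Qed.

Lemma dIm1 : dIm 1 = 0.
Proof. by have := dIm_alg 1; rewrite scale1r. Qed.

Lemma dRe_dy : dRe (dy F) = 0.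
Proof. by rewrite /dRe dyE coefX. Qed.

Lemma dIm_dy : dIm (dy F) = 1.
Proof. by rewrite /dIm dyE coefX. Qed.

Lemma dReD a b : dRe (a + b) = dRe a + dRe b. Proof. exact: coefD. Qed.
Lemma dImD a b : dIm (a + b) = dIm a + dIm b. Proof. exact: coefD. Qed.
Lemma dReN a : dRe (- a) = - dRe a. Proof. exact: coefN. Qed.
Lemma dImN a : dIm (- a) = - dIm a. Proof. exact: coefN. Qed.

Lemma dRe_star a : dRe (dstar a) = dRe a.
Proof. by rewrite /dRe dstarE coefB coefC coefZ coefX mulr0 subr0. Qed.

Lemma dIm_star a : dIm (dstar a) = - dIm a.
Proof. by rewrite /dIm dstarE coefB coefC coefZ coefX mulr1 sub0r. Qed.

Definition dualE := (dReM, dImM, dReD, dImD, dReN, dImN, dRe_star, dIm_star,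
  dRe_alg, dIm_alg, dRe0, dIm0, dRe1, dIm1, dRe_dy, dIm_dy).

Lemma dual1B a : dRe a = 1 -> 1 - a = dy F * - (dIm a)%:A.
Proof. by move=> a0; apply: dual_eq; rewrite !dualE ?a0; ring. Qed.

End DualNumbers.

(** * The form induced on V/yV, and reflections *)

Section Reduction.
Variables (F : finFieldType) (V : finLmodType (dual F)) (h : V -> V -> dual F).
Hypothesis hh : nondeg_hermitian h.
Hypothesis F_odd : 2%N \notin [pchar F].

Local Notation b := (red_form h).
Local Notation yV := (yV V).

Lemma two_neq0 : 2 != 0 :> F.
Proof. by apply: contra F_odd => e; rewrite inE /=. Qed.

Lemma red_formC u v : b u v = b v u.
Proof. by rewrite /red_form (herm_conj hh) -/(dRe _) dRe_star. Qed.

Lemma red_formDr u v w : b u (v + w) = b u v + b u w.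
Proof. by rewrite /red_form (herm_addr hh) -/(dRe _) dReD. Qed.

Lemma red_formZr a u v : b u (a *: v) = dRe a * b u v.
Proof. by rewrite /red_form (herm_scaler hh) -/(dRe _) dReM. Qed.

Lemma red_formDl u v w : b (u + v) w = b u w + b v w.
Proof. by rewrite !(red_formC _ w) red_formDr. Qed.

Lemma red_formZl a u v : b (a *: u) v = dRe a * b u v.
Proof. by rewrite !(red_formC _ v) red_formZr. Qed.

Lemma red_formNr u v : b u (- v) = - b u v.
Proof. by rewrite -scaleN1r red_formZr dReN dRe1 mulN1r. Qed.

Lemma red_formNl u v : b (- u) v = - b u v.
Proof. by rewrite !(red_formC _ v) red_formNr. Qed.

Definition red_formE := (red_formDr, red_formDl, red_formNr, red_formNl,
  red_formZr, red_formZl).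

Lemma red_form_yVr u v : v \in yV -> b u v = 0.
Proof. by case/yVP=> w ->; rewrite red_formZr dRe_dy mul0r. Qed.

Lemma red_form_congr u v : u - v \in yV -> b u u = b v v.
Proof.
rewrite -{2 3}[u](subrK v); move: (u - v) => d dy.
by rewrite !red_formDr !red_formDl (red_formC _ v) !(red_form_yVr _ dy) !add0r.
Qed.

(** A norm is fixed by the involution, which negates the coefficient of y; in odd characteristic
    that coefficient is 0. *)
Lemma herm_norm v : h v v = (b v v)%:A.
Proof.
apply: dual_eq; first by rewrite dRe_alg.
have := congr1 (@dIm F) (herm_conj hh v v).
rewrite dIm_star dIm_alg => /eqP; rewrite -addr_eq0 -mulr2n -mulr_natl.
by rewrite mulf_eq0 (negPf two_neq0) => /eqP.
Qed.

Lemma herm_Nr u v : h u (- v) = - h u v.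
Proof. by rewrite -scaleN1r (herm_scaler hh) mulN1r. Qed.

Lemma herm_scalel a u v : h (a *: u) v = dstar a * h u v.
Proof.
rewrite (herm_conj hh v) (herm_scaler hh) (herm_conj hh v u).
by apply: dual_eq; rewrite !dualE; ring.
Qed.

Lemma herm_NN u v : h (- u) (- v) = h u v.
Proof.
rewrite herm_Nr -[- u]scaleN1r herm_scalel -mulNr -[RHS]mul1r; congr (_ * _).
by apply: dual_eq; rewrite !dualE; ring.
Qed.

(* The reflection in a vector of non-zero norm of V/yV lifts to U because its  *)
(* norm lies in F, hence is a unit of A fixed by the involution.               *)
Definition reflection u x : V := x - ((2 / b u u)%:A * h u x) *: u.

Lemma reflectionK u : b u u != 0 -> involutive (reflection u).
Proof.
move=> u0 x; rewrite /reflection -[X in _ = X]addr0 -addrA; congr (_ + _).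
apply/eqP; rewrite -opprD oppr_eq0 -scalerDl (herm_addr hh) -scaleNr.
rewrite (herm_scaler hh) (herm_norm u); move: (h u x) => k; set c := _ + _.
suff -> : c = 0 by rewrite scale0r.
by apply: dual_eq; rewrite /c !dualE; field.
Qed.

Definition reflection_perm u (u0 : b u u != 0) : {perm V} :=
  perm (can_inj (reflectionK u0)).

Lemma reflection_unitary u (u0 : b u u != 0) :
  reflection_perm u0 \in unitary h.
Proof.
apply/unitaryP; split=> [a x y|x y]; rewrite !permE /reflection.
  rewrite (herm_addr hh) (herm_scaler hh) scalerBr scalerA addrACA -opprD.
  by rewrite -scalerDl mulrDr mulrCA.
rewrite (herm_addr hh) !(herm_addl hh) -!scaleNr !herm_scalel !(herm_scaler hh).
rewrite (herm_norm u) (herm_conj hh u x).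
move: (h x y) (h u x) (h u y) => p k l.
by apply: dual_eq; rewrite !dualE; field.
Qed.

(** Equal norms give b(v-w, v-w) = 2 b(v-w, v), so the coefficient [c] of v - w in the reflection of
    v is 1 modulo y, and v - c(v-w) is congruent to w. *)
Lemma reflection_sub v w : b v v = b w w -> b (v - w) (v - w) != 0 ->
  reflection (v - w) v - w \in yV.
Proof.
move=> e; rewrite /reflection; set c := (2 / _)%:A * _ => n0.
have n2 : b (v - w) (v - w) = 2 * b (v - w) v.
  by rewrite !red_formE e (red_formC v w); ring.
suff c0 : dRe c = 1.
  have -> : v - c *: (v - w) - w = (1 - c) *: (v - w).
    by rewrite scalerBl scale1r addrAC.
  apply/yVP; exists (- (dIm c)%:A *: (v - w)); rewrite scalerA; congr (_ *: _).
  exact: dual1B.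
rewrite /c dReM dRe_alg -[dRe _]/(b _ _); move: n0.
by rewrite n2 mulf_eq0 negb_or => /andP[? ?]; field; apply/andP.
Qed.

End Reduction.

(** * Transitivity of U on vectors of equal norm *)

Section Transitivity.
Variables (F : finFieldType) (V : finLmodType (dual F)) (h : V -> V -> dual F).
Hypothesis hh : nondeg_hermitian h.
Hypothesis F_odd : 2%N \notin [pchar F].

Local Notation b := (red_form h).
Local Notation yV := (yV V).

Lemma unitary_equiv_trans v w z :
  unitary_equiv h v w -> unitary_equiv h w z -> unitary_equiv h v z.
Proof.
move=> [g gU gvw] [k kU kwz]; exists (g * k)%g.
  by case/group_setP: (unitary_group_set h) => _; apply.
have [kl _] := unitaryP _ _ kU.
rewrite permM -[g v](subrK w) -[X in k (X + _)]scale1r kl scale1r -addrA.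
apply: yVD kwz; have /yVP[u ->] := gvw; apply/yVP; exists (k u).
have k0 : k 0 = 0.
  by apply: (addrI (k 0)); rewrite addr0 -{1}[k 0]scale1r -kl scale1r addr0.
by rewrite -[X in k X]addr0 kl k0 addr0.
Qed.

Lemma unitary_equiv_red_form v w : unitary_equiv h v w -> b v v = b w w.
Proof.
case=> g /unitaryP[_ gh] /(red_form_congr hh) <-.
by rewrite /red_form gh.
Qed.

Lemma unitary_equiv_sub v w : b v v = b w w -> b (v - w) (v - w) != 0 ->
  unitary_equiv h v w.
Proof.
move=> e n0; exists (reflection_perm hh F_odd n0).
  exact: reflection_unitary.
by rewrite permE; apply: reflection_sub.
Qed.

Lemma unitary_equivN v : unitary_equiv h v (- v).
Proof.
exists (perm (inv_inj (@opprK V))).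
  apply/unitaryP; split=> [a x y|x y]; rewrite !permE ?opprD ?scalerN //.
  exact: herm_NN.
by rewrite permE subrr; apply/yVP; exists 0; rewrite scaler0.
Qed.

Hypothesis nd : forall v, v \notin yV -> exists x, b v x != 0.

(** If x serves only v and z serves only w, then x + z serves both. *)
Lemma common_nonorthogonal v w : v \notin yV -> w \notin yV ->
  exists x, b v x != 0 /\ b w x != 0.
Proof.
move=> /nd[x vx] /nd[z wz].
have [wx|wx] := eqVneq (b w x) 0; last by exists x.
have [vz|vz] := eqVneq (b v z) 0; last by exists z.
by exists (x + z); rewrite !red_formDr // wx vz addr0 add0r.
Qed.

(* A reflection in v - w or v + w carries v to w or - w, unless v and w are    *)
(* isotropic and orthogonal; then both are moved to an isotropic vector        *)
(* orthogonal to neither.                                                      *)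
Lemma unitary_transitive v w : v \notin yV -> w \notin yV -> b v v = b w w ->
  unitary_equiv h v w.
Proof.
move=> vy wy e.
have [n0|] := eqVneq (b (v - w) (v - w)) 0; last exact: unitary_equiv_sub.
have [p0|p0] := eqVneq (b (v - - w) (v - - w)) 0; last first.
  apply: (@unitary_equiv_trans v (- w)); last first.
    by rewrite -{2}[w]opprK; apply: unitary_equivN.
  by apply: unitary_equiv_sub p0; rewrite !red_formE // opprK.
have two0 := two_neq0 F_odd.
(* Adding and subtracting b(v-w, v-w) = 0 and b(v+w, v+w) = 0 gives 4 b(v,v) = 0 and 4 b(v,w) =
   0. *)
have [v0 vw0] : b v v = 0 /\ b v w = 0.
  move: n0 p0; rewrite !red_formE // (red_formC hh w) -e => n0 p0.
  have h4 : (2 * 2 : F) != 0 by rewrite mulf_neq0.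
  split; apply: (mulfI h4); rewrite mulr0; last rewrite -(subrr 0) -{1}p0 -n0.
    by rewrite -[RHS]addr0 -{1}n0 -p0; ring.
  by ring.
have [x [vx wx]] := common_nonorthogonal vy wy.
(* As v is isotropic, b(x - kv, x - kv) = b(x,x) - 2k b(v,x); this k makes z isotropic without
   changing the pairings with v and w. *)
pose z := x - (b x x / (2 * b v x))%:A *: v.
have vz : b v z = b v x by rewrite !red_formE // v0 mulr0 subr0.
have wz : b w z = b w x.
  by rewrite !red_formE // (red_formC hh w v) vw0 mulr0 subr0.
have zz : b z z = 0.
  rewrite !red_formE // !dualE v0 (red_formC hh x v).
  by field; rewrite two0 vx.
have isotropic_sub x1 x2 : b x1 x1 = 0 -> b x2 x2 = 0 ->
    b (x1 - x2) (x1 - x2) = - (2 * b x1 x2).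
  by move=> e1 e2; rewrite !red_formE // e1 e2 (red_formC hh x2); ring.
apply: (@unitary_equiv_trans v z); apply: unitary_equiv_sub; rewrite ?zz -?e //.
  by rewrite isotropic_sub // oppr_eq0 mulf_neq0 ?vz.
by rewrite isotropic_sub -?e // oppr_eq0 mulf_neq0 // (red_formC hh) ?wz.
Qed.

End Transitivity.

(** * The degree as half the size of a sphere *)

Section Degree.
Variables (R : realType) (F : finFieldType) (V : finLmodType (dual F)).
Variables (h : V -> V -> dual F) (lam : F -> R[i]) (T : {set V}) (sgn : bool).
Hypothesis hh : nondeg_hermitian h.
Hypothesis F_odd : 2%N \notin [pchar F].
Hypothesis lam_char : nontrivial_char lam.
Hypothesis hT : symmetric_transversal T.
Hypothesis nd : forall v, v \notin yV V -> exists x, red_form h v x != 0.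

Local Notation b := (red_form h).
Local Notation yV := (yV V).
Local Notation C := R[i].
Local Notation weil := (weil R T).
Local Notation act := (weil_act h lam).

Definition weil_pm (v : V) : weil :=
  weil_e R T v + (-1) ^+ sgn *: weil_e R T (- v).

Definition norm_sphere (t : F) : {set V} :=
  [set v in T | (v \notin yV) && (b v v == t)].

(** The enumeration rank serves as an arbitrary total order that picks one vector from each pair v,
    -v. *)
Definition half_sphere (t : F) : {set V} :=
  [set v in norm_sphere t | enum_rank v < enum_rank (- v)]%N.

Lemma weil_pmN v : weil_pm (- v) = (-1) ^+ sgn *: weil_pm v.
Proof.
by rewrite /weil_pm opprK scalerDr scalerA -expr2 sqrr_sign scale1r addrC.
Qed.

(** Since h(-gv, -w) = h(gv, w), both basis vectors acquire the same scalar. *)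
Lemma weil_act_pm (g : {perm V}) (v w : V) : g \in unitary h ->
  v \in T -> w \in T -> g v - w \in yV ->
  act g (weil_pm v) = mu lam (h (g v) w) *: weil_pm w.
Proof.
move=> gU vT wT gvw; have [gl _] := unitaryP _ _ gU.
have g0 : g 0 = 0.
  by apply: (addrI (g 0)); rewrite addr0 -{1}[g 0]scale1r -gl scale1r addr0.
have gN : g (- v) = - g v.
  by rewrite -scaleN1r -[_ *: v]addr0 gl g0 addr0 scaleN1r.
have NvT : - v \in T by rewrite -hT.2.
have NwT : - w \in T by rewrite -hT.2.
have gNvw : g (- v) - - w \in yV by rewrite gN -opprD yVN.
have actE x y (xT : x \in T) (yT : y \in T) : g x - y \in yV ->
    act g (weil_e R T x) = mu lam (h (g x) y) *: weil_e R T y.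
  exact: (@weil_act_e _ _ h _ lam T hT g (exist _ x xT) (exist _ y yT)).
rewrite /weil_pm addrC weil_act_linear (actE _ _ NvT NwT gNvw)
  (actE _ _ vT wT gvw) gN scalerDr scalerA addrC.
congr (_ + _); rewrite scalerA mulrC; congr (mu _ _ * _ *: _).
exact: herm_NN.
Qed.

Lemma norm_sphereN t v : (- v \in norm_sphere t) = (v \in norm_sphere t).
Proof.
rewrite !inE -hT.2; congr (_ && (~~ _ && _)).
  by apply/idP/idP=> /yVN; rewrite ?opprK.
by rewrite !red_formE // opprK.
Qed.

Lemma opp_neq v : v \notin yV -> - v != v.
Proof.
apply: contra => /eqP e; apply/yVP; exists 0; rewrite scaler0.
have : (2%:A : dual F) *: v = 0.
  by rewrite !scaler_nat mulr2n -{1}e addNr.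
move/(congr1 (fun u => (2^-1)%:A *: u)); rewrite scaler0 scalerA => <-.
have -> : (2^-1)%:A * 2%:A = 1 :> dual F; last by rewrite scale1r.
by apply: dual_eq; rewrite !dualE; field; apply: two_neq0.
Qed.

Lemma half_sphereN t v : v \in norm_sphere t ->
  (- v \in half_sphere t) = (v \notin half_sphere t).
Proof.
move=> vO; rewrite [- v \in _]inE [v \in half_sphere _]inE norm_sphereN vO /=.
rewrite opprK -leqNgt [RHS]leq_eqVlt; case: eqP => // /ord_inj/enum_rank_inj e.
by move: vO; rewrite inE => /and3P[_ /opp_neq/eqP].
Qed.

Lemma card_norm_sphere t : #|norm_sphere t| = (2 * #|half_sphere t|)%N.
Proof.
have HO : half_sphere t \subset norm_sphere t.
  by apply/subsetP=> v; rewrite inE => /andP[].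
rewrite -(cardsID (half_sphere t)) (setIidPr HO) mul2n -addnn; congr (_ + _)%N.
rewrite -[RHS](card_imset _ (@oppr_inj V)); apply: eq_card => v.
rewrite inE; apply/andP/imsetP => [[nH vO]|[w wH ->]].
  by exists (- v); rewrite ?opprK // half_sphereN.
have wO := subsetP HO w wH.
by rewrite norm_sphereN half_sphereN // negbK.
Qed.

(** The vectors [weil_pm v], for v in the half sphere, form a basis. *)
Lemma dim_Top_pm s : s \in T -> s \notin yV ->
  (2 * \dim (Top_pm h lam T sgn s))%N = #|norm_sphere (b s s)|.
Proof.
move=> sT sy; rewrite card_norm_sphere; congr (2 * _)%N.
set t := b s s; set H := half_sphere t.
have HO v : v \in H -> v \in norm_sphere t by rewrite inE => /andP[].
pose X := [tuple weil_pm (enum_val i) | i < #|H|].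
have XE (i : 'I_#|H|) : X`_i = weil_pm (enum_val i).
  by rewrite -tnth_nth tnth_mktuple.
have freeX : free X.
  apply/freeP => k k0 j; have jH := enum_valP j.
  have jT : enum_val j \in T by have := HO _ jH; rewrite inE => /andP[].
  pose w : {v : V | v \in T} := exist _ (enum_val j) jT.
  (* Opposites of vectors of [H] lie outside [H], so evaluation at the j-th vector sees only the
     j-th member of the family. *)
  have pmE (i : 'I_#|H|) : weil_pm (enum_val i) w = (j == i)%:R.
    have ji : enum_val j != - enum_val i.
      apply/eqP=> e; have := enum_valP i; rewrite -[_ \in _]negbK.
      by rewrite -half_sphereN ?HO ?enum_valP // -e jH.
    by rewrite !ffunE /= (negPf ji) (inj_eq enum_val_inj) scaler0 addr0.
  have /ffunP/(_ w) := k0.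
  rewrite sum_ffunE (bigD1 j) //= big1 => [|i ij].
    by rewrite addr0 !ffunE XE pmE eqxx [_ *: _]mulr1.
  by rewrite ffunE XE pmE eq_sym (negPf ij) scaler0.
have -> : Top_pm h lam T sgn s = <<X>>%VS.
  apply/eqP; rewrite eqEsubv; apply/andP; split.
    apply/subv_sumP => g gU; rewrite -memvE.
    have [[w wT] /= gw] := transE hT (g s).
    rewrite -/(weil_pm s) (weil_act_pm gU sT wT gw); apply: memvZ.
    have wO : w \in norm_sphere t.
      have e : unitary_equiv h s w by exists g.
      rewrite inE wT -(unitary_equiv_red_form hh e) eqxx andbT /=.
      (* If w were in yV, so would g s be; then g s, and hence s, would be orthogonal to everything,
         against [nd]. *)
      apply/negP=> wy.
      have [x /negP[]] := nd sy.
      have [_ gh] := unitaryP _ _ gU; rewrite /red_form -gh -/(red_form h _ _).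
      rewrite red_formC // red_form_yVr // -[g s](subrK w).
      exact: yVD.
    have memX v : v \in H -> weil_pm v \in <<X>>%VS.
      move=> vH; rewrite -[v](enum_rankK_in vH vH) -XE memv_span //.
      by rewrite mem_nth ?size_tuple.
    have [/memX //|nH] := boolP (w \in H).
    rewrite -[w]opprK weil_pmN memvZ //; apply: memX.
    by rewrite half_sphereN.
  apply/span_subvP => _ /mapP[i _ ->]; have := HO _ (enum_valP i).
  rewrite inE => /and3P[vT vy /eqP vt]; set v := enum_val i in vT vy vt *.
  (* For the reverse inclusion, transitivity makes each [weil_pm v] a multiple of a translate of
     [weil_pm s], the scalar being invertible. *)
  have [g gU gsv] := unitary_transitive hh F_odd nd sy vy (esym vt).
  have c0 : mu lam (h (g s) v) != 0 by apply: char_neq0 lam_char _.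
  rewrite -[weil_pm v](scalerK c0) -(weil_act_pm gU sT vT gsv) memvZ //.
  by apply: (subvP (sumv_sup g _ (subvv _))); rewrite ?memv_line.
by have /eqP := freeX; rewrite size_tuple.
Qed.

End Degree.

(** * Counting solutions of diagonal quadratic equations *)

Section DiagonalCount.
Variable F : finFieldType.
Hypothesis F_odd : 2%N \notin [pchar F].
Implicit Types (m : nat) (D : nat -> F) (t : F).

(** The entries are indexed by [nat], so removing leading coordinates is a mere shift of [D]. *)
Definition diag_form m D (c : {ffun 'I_m -> F}) : F :=
  \sum_(i < m) D i * c i ^+ 2.

Definition diag_count m D t : nat := \sum_(c | @diag_form m D c == t) 1.

Lemma diag_count0 D t : diag_count 0 D t = (t == 0).
Proof.
rewrite /diag_count (eq_bigl (fun c => t == 0)) => [|c]; last first.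
  by rewrite /diag_form big_ord0 eq_sym.
have [_|_] := eqVneq; last by rewrite big_pred0.
by rewrite sum1_card card_ffun card_ord expn0.
Qed.

Lemma diag_countS m D t :
  diag_count m.+1 D t =
  (\sum_x diag_count m (fun i => D i.+1) (t - D 0%N * x ^+ 2)%R)%N.
Proof.
pose cons (p : F * {ffun 'I_m -> F}) : {ffun 'I_m.+1 -> F} :=
  [ffun i => oapp p.2 p.1 (unlift ord0 i)].
pose uncons (c : {ffun 'I_m.+1 -> F}) := (c ord0, [ffun i => c (lift ord0 i)]).
have consK : cancel cons uncons.
  move=> [x c]; rewrite /uncons ffunE unlift_none; congr (_, _).
  by apply/ffunP=> i; rewrite !ffunE liftK.
have unconsK : cancel uncons cons.
  by move=> c; apply/ffunP=> i; rewrite ffunE /=; case: unliftP => [j|] -> /=;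
    rewrite ?ffunE.
rewrite /diag_count (reindex cons); last by exists uncons => p _.
rewrite pair_big_dep /=; apply: eq_bigl => -[x c] /=.
rewrite [RHS]eq_sym subr_eq eq_sym /diag_form big_ord_recl ffunE unlift_none /=.
rewrite [in RHS]addrC; congr (_ == _ + _); apply: eq_bigr => i _.
by rewrite ffunE liftK.
Qed.

Lemma sum_diag_count m D : (\sum_t diag_count m D t = #|F| ^ m)%N.
Proof.
rewrite (exchange_big_dep predT) //= (eq_bigr (fun=> 1%N)) => [|c _].
  by rewrite sum1_card card_ffun card_ord.
by rewrite (big_pred1 (diag_form D c)) // => t; rewrite eq_sym.
Qed.

(* The substitution u = x - y, v = x + y turns x^2 - y^2 into u * v.           *)
Lemma diag_count_hyperbolic m D t : D 0%N = 1 -> D 1%N = -1 ->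
  diag_count m.+2 D t =
  (#|F| * diag_count m (fun i => D i.+2) t + #|F|.-1 * #|F| ^ m)%N.
Proof.
move=> D0 D1; have two0 := two_neq0 F_odd.
rewrite diag_countS; under eq_bigr do rewrite diag_countS D0 D1.
set f := diag_count m _.
pose phi (p : F * F) := ((p.1 + p.2) / 2, (p.2 - p.1) / 2).
pose psi (p : F * F) := (p.1 - p.2, p.1 + p.2).
have phiK : cancel phi psi.
  by move=> [u v]; rewrite /phi /psi /=; congr (_, _); field.
have psiK : cancel psi phi.
  by move=> [u v]; rewrite /phi /psi /=; congr (_, _); field.
rewrite pair_big (reindex phi) /=; last by exists psi => p _.
transitivity (\sum_u \sum_v f (t - u * v)%R)%N.
  rewrite pair_big; apply: eq_bigr => -[u v] _ /=; congr f.
  by field.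
(* The term u = 0 gives q f(t). For each other u, t - uv runs over all of F, so the inner sum is the
   total q^m. *)
rewrite (bigD1 0) //=; congr (_ + _)%N.
  under eq_bigr do rewrite mul0r subr0.
  by rewrite sum_nat_const.
rewrite -(sum_diag_count m (fun i => D i.+2)) -/f -(cardC1 (0 : F)).
rewrite -sum_nat_const; apply: eq_bigr => u u0.
rewrite (reindex (fun v => (t - v) / u)) /=.
  by apply: eq_bigr => v _; congr f; field.
by exists (fun v => t - u * v) => v _; field.
Qed.

(** The deviation from the mean is multiplied by q^k. Over [rat] the power q^(k+m-1) makes sense
    even for k = m = 0. *)
Lemma diag_count_hyperbolics k m D t :
  (forall i, (i < 2 * k)%N -> D i = (-1) ^+ i) ->
  (diag_count (2 * k + m)%N D t)%:R =
  #|F|%:R ^+ k * (diag_count m (fun i => D (2 * k + i)%N) t)%:R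
  + (#|F|%:R ^+ k - 1) * #|F|%:R ^+ (k + m) / #|F|%:R :> rat.
Proof.
have q_gt0 : (0 < #|F|)%N by apply/card_gt0P; exists 0.
have q0 : #|F|%:R != 0 :> rat by rewrite pnatr_eq0 -lt0n.
elim: k D => [|k IHk] D De; first by rewrite expr0 subrr !mul0r addr0 mul1r.
have -> : (2 * k.+1 + m = (2 * k + m).+2)%N by rewrite mulnS.
rewrite diag_count_hyperbolic ?De ?mulnS //.
rewrite natrD !natrM IHk => [|i i2k]; last first.
  by rewrite De ?mulnS // !exprS !mulN1r opprK.
rewrite -subn1 natrB // natrX !exprD !exprS expr0.
by field.
Qed.

Lemma card_sqr_roots_le (d z : F) : z != 0 ->
  (\sum_(x : F | (d * x ^+ 2 == z)%R) 1 <= 2)%N.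
Proof.
move=> z0; rewrite sum1_card.
have [/eqP->//|/pred0Pn[x /eqP xz]] := boolP (pred0b [pred x | d * x ^+ 2 == z]).
apply: leq_trans (_ : #|[set x; - x]| <= 2)%N; last by rewrite cards2; case: eqP.
apply/subset_leq_card/subsetP => y /eqP yz; rewrite !inE -eqf_sqr.
have d0 : d != 0 by apply: contraNneq z0 => d0; rewrite -xz d0 mul0r.
by apply/eqP/(mulfI d0); rewrite yz.
Qed.

Lemma card_sqr_roots0 (d : F) : d != 0 ->
  (\sum_(x : F | (d * x ^+ 2 == 0)%R) 1 = 1)%N.
Proof.
by move=> d0; rewrite (big_pred1 0) // => x; rewrite mulf_eq0 (negPf d0) sqrf_eq0.
Qed.

(* Each z has at most two preimages under x |-> x^2 and x |-> d x^2 together,  *)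
(* and the average over z is exactly two.                                      *)
Lemma card_sqr_roots (d z : F) : nznonsquare d ->
  (\sum_(x : F | (x ^+ 2 == z)%R) 1 + \sum_(x : F | (d * x ^+ 2 == z)%R) 1 = 2)%N.
Proof.
move=> [d0 dns].
pose r (e y : F) := (\sum_(x : F | (e * x ^+ 2 == y)%R) 1)%N.
have r_le (y : F) : (r 1%R y + r d y <= 2)%N.
  have [->|y0] := eqVneq y 0; first by rewrite /r !card_sqr_roots0 ?oner_eq0.
  (* If a non-zero y were both x1^2 and d x^2, then d = (x1/x)^2 would be a square; so only one of
     the two equations can have roots. *)
  have [x1 /eqP|no1] := pickP [pred x | 1 * x ^+ 2 == y]; last first.
    by rewrite {1}/r big_pred0 // add0n card_sqr_roots_le.
  rewrite mul1r => x1y; rewrite [r d y]big_pred0 ?addn0 ?card_sqr_roots_le // => x.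
  apply/negP=> /eqP xy; apply: dns.
  have x0 : x != 0.
    by apply: contraNneq y0 => x0; rewrite -xy x0 expr0n mulr0.
  exists (x1 / x); last by rewrite expr_div_n x1y -xy mulfK // expf_neq0.
  rewrite mulf_neq0 ?invr_eq0 //.
  by apply: contraNneq y0 => x10; rewrite -x1y x10 expr0n.
have sum_r (e : F) : (\sum_(y : F) r e y = #|F|)%N.
  rewrite (exchange_big_dep predT) //= -sum1_card; apply: eq_bigr => x _.
  by rewrite (big_pred1 (e * x ^+ 2)) // => y; rewrite eq_sym.
(* Both totals equal 2q, which forces equality in each termwise bound. *)
have [_] := leqif_sum (fun (y : F) (_ : true) => leqif_eq (r_le y)).
rewrite big_split /= !sum_r sum_nat_const muln2 addnn eqxx => /esym/forallP/(_ z).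
move/eqP; rewrite {1}/r; under [X in (X + _)%N]eq_bigl do rewrite mul1r.
by [].
Qed.

Lemma diag_count1 D t :
  diag_count 1 D t = (\sum_(x : F | (D 0%N * x ^+ 2 == t)%R) 1)%N.
Proof.
rewrite diag_countS [RHS]big_mkcond; apply: eq_bigr => x _.
by rewrite diag_count0 subr_eq0 eq_sym; case: eqP.
Qed.

(** Summing over the shared leading coordinates reduces to one variable, where [card_sqr_roots] at
    -t applies. As 2 q^m is twice the mean, the two deviations are opposite. *)
Lemma diag_count_twist m D D' d t : nznonsquare d ->
  (forall i, (i < m)%N -> D i = D' i) -> D m = -1 -> D' m = - d ->
  (diag_count m.+1 D t + diag_count m.+1 D' t = 2 * #|F| ^ m)%N.
Proof.
move=> dns; elim: m D D' t => [|m IHm] D D' t eD Dm Dm'.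
  rewrite !diag_count1 Dm Dm' expn0 muln1 -[RHS](card_sqr_roots (- t) dns).
  by congr (_ + _)%N; apply: eq_bigl => x;
    rewrite ?mulN1r ?mulNr eqr_oppLR.
rewrite !(diag_countS m.+1) -big_split /=.
rewrite (eq_bigr (fun=> (2 * #|F| ^ m)%N)) => [|x _]; last first.
  by rewrite -(eD 0%N) //; apply: IHm => // i im; apply: eD.
by rewrite sum_nat_const expnS mulnCA.
Qed.

End DiagonalCount.

(** * Coordinates on V/yV in an orthogonal basis *)

Section Coordinates.
Variables (F : finFieldType) (V : finLmodType (dual F)) (h : V -> V -> dual F).
Hypothesis hh : nondeg_hermitian h.
Variables (m : nat) (e : 'I_m -> V) (D : nat -> F).
Hypothesis e_basis : red_basis e.
Hypothesis e_gram : forall i j, red_form h (e i) (e j) = D i *+ (i == j).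

Local Notation b := (red_form h).
Local Notation yV := (yV V).

Definition red_comb (c : {ffun 'I_m -> F}) : V := \sum_i (c i)%:A *: e i.

Lemma red_coord_ex v : exists c, v - red_comb c \in yV.
Proof. by have [c []] := e_basis v; exists c. Qed.

Definition red_coord v := xchoose (red_coord_ex v).

Lemma red_coordP v : v - red_comb (red_coord v) \in yV.
Proof. exact: xchooseP (red_coord_ex v). Qed.

Lemma red_coord_eq v c : v - red_comb c \in yV -> red_coord v = c.
Proof.
have [c' [_ uc]] := e_basis v => vc.
by rewrite -(uc c vc) -(uc _ (red_coordP v)).
Qed.

Lemma red_form_combr u c : b u (red_comb c) = \sum_i c i * b u (e i).
Proof.
have b0 : b u 0 = 0 by rewrite -[0](scale0r 0) red_formZr // dRe0 mul0r.
rewrite /red_comb (big_morph (b u) (red_formDr hh u) b0).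
by apply: eq_bigr => i _; rewrite red_formZr // dRe_alg.
Qed.

Lemma red_form_comb_e c i : b (e i) (red_comb c) = D i * c i.
Proof.
rewrite red_form_combr (bigD1 i) //= big1 => [|j ij].
  by rewrite e_gram eqxx addr0 mulrC.
by rewrite e_gram eq_sym (negPf ij) mulr0.
Qed.

Lemma red_form_coord v : b v v = diag_form D (red_coord v).
Proof.
rewrite (red_form_congr hh (red_coordP v)) red_form_combr; apply: eq_bigr => i _.
by rewrite red_formC // red_form_comb_e mulrCA -expr2.
Qed.

Lemma red_comb0 : red_comb 0 = 0.
Proof. by apply: big1 => i _; rewrite ffunE !scale0r. Qed.

Lemma red_coord_eq0 v : (red_coord v == 0) = (v \in yV).
Proof.
apply/eqP/idP => [v0|vy]; last by apply: red_coord_eq; rewrite red_comb0 subr0.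
by have := red_coordP v; rewrite v0 red_comb0 subr0.
Qed.

(** Supplies the hypothesis [nd] of the earlier sections: if the i-th coordinate of v is non-zero,
    then [e i] pairs with v to a non-zero value. *)
Lemma red_form_nondeg : (forall i : 'I_m, D i != 0) ->
  forall v, v \notin yV -> exists x, b v x != 0.
Proof.
move=> D0 v; rewrite -red_coord_eq0 => vn0.
have /existsP[i ci] : [exists i, red_coord v i != 0].
  apply: contraNT vn0; rewrite negb_exists => /forallP c0.
  apply/eqP/ffunP => i; rewrite [RHS]ffunE; apply/eqP.
  by have := c0 i; rewrite negbK.
exists (e i); rewrite red_formC // -[v](subrK (red_comb (red_coord v))).
rewrite red_formDr // red_form_yVr ?red_coordP // add0r.
by rewrite red_form_comb_e mulf_neq0.
Qed.

(** As [T] meets each class once, [red_coord] matches the sphere with the non-zero solutions; the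
    zero vector is one more solution exactly when t = 0. *)
Lemma card_norm_sphere_diag (T : {set V}) (t : F) : symmetric_transversal T ->
  (#|norm_sphere h T t| + (t == 0%R) = diag_count m D t)%N.
Proof.
move=> hT; set O := norm_sphere h T t.
have inj : {in O &, injective red_coord}.
  move=> v w; rewrite !inE => /and3P[vT _ _] /and3P[wT _ _] vw.
  have [u [_ uu]] := hT.1 v; rewrite -(uu v) ?(uu w) //; split=> //.
    rewrite -(subrKA (red_comb (red_coord v))) yVD ?red_coordP //.
    by rewrite -opprB yVN // vw red_coordP.
  by rewrite subrr; apply/yVP; exists 0; rewrite scaler0.
rewrite -(card_in_imset inj) /diag_count sum1dep_card.
rewrite [RHS](cardsD1 (0 : {ffun 'I_m -> F})) [RHS]addnC inE.
congr (_ + _)%N; last first.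
  by rewrite eq_sym /diag_form big1 // => i _; rewrite ffunE expr0n mulr0.
apply: eq_card => c; rewrite !inE.
apply/imsetP/andP => [[v vO ->]|[c0 ct]].
  move: vO; rewrite inE => /and3P[_ vy /eqP vt].
  by rewrite red_coord_eq0 vy -red_form_coord vt eqxx.
have [[v vT] /= cv] := transE hT (red_comb c).
have cE : red_coord v = c by apply: red_coord_eq; rewrite -opprB yVN.
by exists v; rewrite // inE vT -red_coord_eq0 red_form_coord cE c0 ct.
Qed.

End Coordinates.

(** * Solution counts for the two types *)

Section TypeCount.
Variables (F : finFieldType) (delta : F).
Hypothesis F_odd : 2%N \notin [pchar F].
Hypothesis delta_nsq : nznonsquare delta.
Local Notation q := (#|F|%:R : rat).

(** The entries of [type_diag], extended to [nat] indices as [diag_count] requires. *)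
Definition type_entry m (d : F) (i : nat) : F :=
  if i.+1 == m then - d else (-1) ^+ i.

Lemma card_field_neq0 : q != 0.
Proof. by rewrite pnatr_eq0 -lt0n; apply/card_gt0P; exists 0. Qed.

Lemma type_count_twist m t : (0 < m)%N ->
  (diag_count m (type_entry m delta) t)%:R =
  2 * q ^+ m.-1 - (diag_count m (type_entry m 1) t)%:R.
Proof.
case: m => // m _; apply/eqP; rewrite -subr_eq opprK addrC eq_sym; apply/eqP.
rewrite -natrD (diag_count_twist _ delta_nsq) => [|i im||].
- by rewrite natrM natrX.
- by rewrite /type_entry eqSS (ltn_eqF im).
- by rewrite /type_entry eqxx.
- by rewrite /type_entry eqxx.
Qed.

Lemma type1_count_even r t : (0 < r)%N ->
  (diag_count (2 * r)%N (type_entry (2 * r)%N 1) t)%:R =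
  q ^+ r * (t == 0)%:R + (q ^+ r - 1) * q ^+ r.-1.
Proof.
case: r => // r _; have q0 := card_field_neq0.
have -> : diag_count (2 * r.+1)%N (type_entry (2 * r.+1)%N 1) t =
    diag_count (2 * r.+1 + 0)%N (type_entry (2 * r.+1)%N 1) t by rewrite addn0.
rewrite diag_count_hyperbolics // => [|i i2r].
  by rewrite diag_count0 addn0 exprSr /=; field.
(* The last index 2r - 1 is odd, so the final entry -1 continues the alternating pattern. *)
rewrite /type_entry; case: eqP => // e.
have : odd i by rewrite -[odd i]negbK -oddS e oddM.
by rewrite -signr_odd => ->; rewrite expr1.
Qed.

Lemma type1_count_odd r t :
  (diag_count (2 * r + 1)%N (type_entry (2 * r + 1)%N 1) t)%:R =
  q ^+ r * (\sum_(x : F | (- x ^+ 2 == t)%R) 1)%N%:R + (q ^+ r - 1) * q ^+ r.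
Proof.
rewrite diag_count_hyperbolics // => [|i i2r].
  rewrite [(r + 1)%N]addn1 exprSr mulrA mulfK ?card_field_neq0 // diag_count1.
  rewrite /type_entry addn0 -addn1 eqxx; congr (_ * _%:R + _).
  by apply: eq_bigl => x; rewrite mulN1r.
by rewrite /type_entry addn1 eqSS (ltn_eqF i2r).
Qed.

Lemma card_neg_sqr0 : (\sum_(x : F | (- x ^+ 2 == 0)%R) 1 = 1)%N.
Proof. by rewrite (big_pred1 0) // => x; rewrite oppr_eq0 sqrf_eq0. Qed.

Lemma card_neg_sqr_square (t : F) :
  nzsquare (-1 : F) /\ nzsquare t \/ nznonsquare (-1 : F) /\ nznonsquare t ->
  (\sum_(x : F | (- x ^+ 2 == t)%R) 1 = 2)%N.
Proof.
case=> [[[z z0 ez] [w w0 tw]]|[ns1 [t0 nst]]]; last first.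
  (* Here -1 itself is the non-square [d]: x^2 = t has no root, so both roots belong to -x^2 = t. *)
  rewrite -[RHS](card_sqr_roots t ns1) [X in (X + _)%N]big_pred0 => [|x]; last first.
    apply/negP=> /eqP xt; apply: nst; exists x => //.
    by apply: contraNneq t0 => x0; rewrite -xt x0 expr0n.
  by apply: eq_bigl => x; rewrite mulN1r.
(* Here -t = (zw)^2, so [delta] x^2 = -t would make [delta] a square; both roots belong to x^2 =
   -t. *)
rewrite -[RHS](card_sqr_roots (- t) delta_nsq) [X in (_ + X)%N]big_pred0 => [|x].
  by rewrite addn0; apply: eq_bigl => x; rewrite eqr_oppLR.
apply/negP=> /eqP xt; have [d0 dns] := delta_nsq; apply: dns.
have x0 : x != 0.
  apply: contraNneq w0 => x0; move: xt.
  by rewrite x0 expr0n mulr0 => /esym/eqP; rewrite oppr_eq0 tw sqrf_eq0.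
exists (z * w / x); first by rewrite !mulf_neq0 ?invr_eq0.
by rewrite expr_div_n exprMn -ez -tw mulN1r -xt mulfK // expf_neq0.
Qed.

(** From -x^2 = t, either -1 = z^2 gives t = (zx)^2, or t = w^2 gives -1 = (w/x)^2. *)
Lemma card_neg_sqr_nonsquare (t : F) :
  nzsquare (-1 : F) /\ nznonsquare t \/ nznonsquare (-1 : F) /\ nzsquare t ->
  (\sum_(x : F | (- x ^+ 2 == t)%R) 1 = 0)%N.
Proof.
case=> [[[z z0 ez] [t0 nst]]|[[_ ns1] [w w0 tw]]]; rewrite big_pred0 // => x;
  apply/negP=> /eqP xt.
  apply: nst; exists (z * x); last by rewrite exprMn -ez mulN1r.
  rewrite mulf_neq0 //; apply: contraNneq t0 => x0.
  by rewrite -xt x0 expr0n oppr0.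
have x0 : x != 0.
  apply: contraNneq w0 => x0; move: xt.
  by rewrite x0 expr0n oppr0 tw => /esym/eqP; rewrite sqrf_eq0.
apply: ns1; exists (w / x); first by rewrite mulf_neq0 ?invr_eq0.
by rewrite expr_div_n -tw -xt mulNr divff // expf_neq0.
Qed.

End TypeCount.

(** * From solution counts to degrees *)

Lemma deg_Top_pm_count (R : realType) (F : finFieldType) m
  (V : finLmodType (dual F)) (h : V -> V -> dual F) (lam : F -> R[i])
  (T : {set V}) (d : F) (s : V) (sgn : bool) :
  2%N \notin [pchar F] -> nondeg_hermitian h -> nontrivial_char lam ->
  symmetric_transversal T -> s \in T -> s \notin yV V ->
  d != 0 -> of_type h m d ->
  2 * (\dim (Top_pm h lam T sgn s))%:R + (red_form h s s == 0)%:R =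
  (diag_count m (type_entry m d) (red_form h s s))%:R :> rat.
Proof.
move=> F_odd hh lam_char hT sT sy d0 [e [e_basis /matrixP e_gram]].
have gram i j : red_form h (e i) (e j) = type_entry m d i *+ (i == j).
  by have := e_gram i j; rewrite !mxE.
have nd : forall v, v \notin yV V -> exists x, red_form h v x != 0.
  apply: (red_form_nondeg hh e_basis gram) => i.
  by rewrite /type_entry; case: ifP => _;
    rewrite ?oppr_eq0 // -sqrf_eq0 sqrr_sign oner_eq0.
rewrite -(card_norm_sphere_diag hh e_basis gram _ hT).
by rewrite -(dim_Top_pm sgn hh F_odd lam_char hT nd) // natrD natrM.
Qed.

Theorem theorem11p1 (R : realType) (F : finFieldType) (m r : nat)
  (V : finLmodType (dual F)) (h : V -> V -> dual F)
  (lam : F -> R[i]) (T S : {set V}) (delta : F) (s : V) (t : F) (sgn : bool)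
  (F_odd : 2%N \notin [pchar F])
  (m_ge2 : (2 <= m)%N)
  (m_r : m = (2 * r)%N \/ m = (2 * r + 1)%N)
  (V_free : free_of_rank V m)
  (h_herm : nondeg_hermitian h)
  (lam_char : nontrivial_char lam)
  (T_transversal : symmetric_transversal T)
  (S_reps : orbit_reps h T S)
  (delta_nsq : nznonsquare delta)
  (s_S : s \in S)
  (t_def : h s s = t%:A) :
  let q : rat := #|F|%:R in
  let deg : rat := (\dim (Top_pm h lam T sgn s))%:R in
  (m = (2 * r + 1)%N ->
     [\/ [/\ of_type h m 1, nzsquare (- 1 : F) & nzsquare t],
         [/\ of_type h m 1, nznonsquare (- 1 : F) & nznonsquare t],
         [/\ of_type h m delta, nzsquare (- 1 : F) & nznonsquare t] |
         [/\ of_type h m delta, nznonsquare (- 1 : F) & nzsquare t]] ->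
     deg = q ^+ r * (q ^+ r + 1) / 2) /\
  (m = (2 * r + 1)%N ->
     [\/ [/\ of_type h m 1, nzsquare (- 1 : F) & nznonsquare t],
         [/\ of_type h m 1, nznonsquare (- 1 : F) & nzsquare t],
         [/\ of_type h m delta, nzsquare (- 1 : F) & nzsquare t] |
         [/\ of_type h m delta, nznonsquare (- 1 : F) & nznonsquare t]] ->
     deg = q ^+ r * (q ^+ r - 1) / 2) /\
  (m = (2 * r)%N -> of_type h m delta -> t != 0 ->
     deg = q ^+ r.-1 * (q ^+ r + 1) / 2) /\
  (m = (2 * r)%N -> of_type h m 1 -> t != 0 ->
     deg = q ^+ r.-1 * (q ^+ r - 1) / 2) /\
  (m = (2 * r)%N -> of_type h m 1 -> t = 0 ->
     deg = (q ^+ r - 1) * (q ^+ r.-1 + 1) / 2) /\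
  (m = (2 * r)%N -> (2 < m)%N -> of_type h m delta -> t = 0 ->
     deg = (q ^+ r + 1) * (q ^+ r.-1 - 1) / 2) /\
  (m = (2 * r + 1)%N -> of_type h m 1 \/ of_type h m delta -> t = 0 ->
     deg = (q ^+ (2 * r) - 1) / 2).
Proof.
move=> q deg; have [ST Sy _] := S_reps.
have sT := subsetP ST s s_S; have sy := Sy s s_S.
have ts : red_form h s s = t by rewrite /red_form t_def -/(dRe _) dRe_alg.
have q0 : q != 0 by apply: card_field_neq0.
have [d0 _] := delta_nsq.
have degE d : d != 0 -> of_type h m d ->
    deg = ((diag_count m (type_entry m d) t)%:R - (t == 0)%:R) / 2.
  move=> dn0 hd; have := deg_Top_pm_count sgn F_odd h_herm lam_char
    T_transversal sT sy dn0 hd.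
  by rewrite ts -/deg => <-; field.
have deg1 := degE 1 (oner_neq0 F); have degd := degE delta d0.
have m_gt0 : (0 < m)%N by apply: ltnW.
have twist := type_count_twist delta_nsq t m_gt0.
have odd1 : m = (2 * r + 1)%N -> (diag_count m (type_entry m 1) t)%:R =
    q ^+ r * (\sum_(x : F | (- x ^+ 2 == t)%R) 1)%N%:R + (q ^+ r - 1) * q ^+ r.
  by move=> ->; apply: type1_count_odd.
have qm_odd : m = (2 * r + 1)%N -> q ^+ m.-1 = q ^+ r * q ^+ r.
  by move=> ->; rewrite addn1 mul2n -addnn exprD.
(* Since m > 0, r is positive and [r.-1] is a genuine predecessor. *)
have even_r : m = (2 * r)%N -> exists r', r = r'.+1.
  by case: (r) => [e|r' _]; [move: m_gt0; rewrite e | exists r'].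
have even1 : m = (2 * r)%N -> (diag_count m (type_entry m 1) t)%:R =
    q ^+ r * (t == 0)%:R + (q ^+ r - 1) * q ^+ r.-1.
  by move=> e; have [r' er] := even_r e; rewrite e er; apply: type1_count_even.
have qm_even : m = (2 * r)%N -> q ^+ m.-1 = q * q ^+ r.-1 * q ^+ r.-1.
  move=> e; have [r' er] := even_r e.
  by rewrite e er mul2n -addnn /= exprD exprS mulrC.
have qr_even : m = (2 * r)%N -> q ^+ r = q * q ^+ r.-1.
  by move=> e; have [r' ->] := even_r e; rewrite exprS.
have nonsq0 : nznonsquare t -> (t == 0) = false by case=> /negPf.
have sq0 : nzsquare t -> (t == 0) = false.
  by case=> z z0 ->; rewrite sqrf_eq0 (negPf z0).
have sumsq := card_neg_sqr_square delta_nsq.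
have sumns := @card_neg_sqr_nonsquare F.
split.
  move=> em [] [hb h1 ht].
  - by rewrite deg1 // odd1 // sumsq ?sq0 //=; [field | left].
  - by rewrite deg1 // odd1 // sumsq ?nonsq0 //=; [field | right].
  (* For type delta the deviation changes sign, so zero roots of -x^2 = t now give the larger
     degree. *)
  - by rewrite degd // twist odd1 // qm_odd // sumns ?nonsq0 //=; [field | left].
  - by rewrite degd // twist odd1 // qm_odd // sumns ?sq0 //=; [field | right].
split.
  move=> em [] [hb h1 ht].
  - by rewrite deg1 // odd1 // sumns ?nonsq0 //=; [field | left].
  - by rewrite deg1 // odd1 // sumns ?sq0 //=; [field | right].
  - by rewrite degd // twist odd1 // qm_odd // sumsq ?sq0 //=; [field | left].
  - by rewrite degd // twist odd1 // qm_odd // sumsq ?nonsq0 //=; [field | right].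
split.
  move=> em hb /negPf t0.
  by rewrite degd // twist even1 // t0 qm_even // qr_even //=; field.
split.
  by move=> em hb /negPf t0; rewrite deg1 // even1 // t0 qr_even //=; field.
split.
  by move=> em hb t0; rewrite deg1 // even1 // t0 eqxx qr_even //=; field.
split.
  move=> em _ hb t0.
  by rewrite degd // twist even1 // t0 eqxx qm_even // qr_even //=; field.
(* For t = 0 the single root of -x^2 = 0 makes the count equal to its mean q^(2r), so both types
   agree. *)
move=> em hb t0; rewrite mul2n -addnn exprD.
case: hb => hb.
  by rewrite deg1 // odd1 // t0 card_neg_sqr0 eqxx /=; field.
by rewrite degd // twist odd1 // qm_odd // t0 card_neg_sqr0 eqxx /=; field.
Qed.
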